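(* Assume the activation and data assumptions below, and that Conditions 1 and 2 hold for the metric $G$. Let $0<\eta\alpha<2$. Then for sufficiently large $M$, with high probability, for all $t\ge0$, $$\|g(\theta_t)\|_2\le\Big(|1-\eta\alpha|+\tfrac{A'}{\sqrt M}\Big)^tR_0,\qquad \sum_{j=1}^t\|\theta_j-\theta_{j-1}\|_2\le AR_0\sum_{j=1}^t\Big(|1-\eta\alpha|+\tfrac{A'}{\sqrt M}\Big)^{j-1}\le\frac{2AR_0}{1-|1-\eta\alpha|},$$ where $A'=4KA^2R_0/(1-|1-\eta\alpha|)$.
   Context: Network: for $l=1,\dots,L$, $u_l=\frac{\sigma_w}{\sqrt{M_{l-1}}}W_lh_{l-1}+\sigma_b b_l$, $h_l=\phi(u_l)$, $h_0=x\in\mathbb{R}^{M_0}$; hidden widths $M_l=\alpha_lM$ ($\alpha_l>0$, $l<L$), $M_L=C$; output $f_\theta=u_L$; $\theta\in\mathbb{R}^P$ all parameters; initialization $\theta_0$ with all entries i.i.d. $\mathcal{N}(0,1)$. Assumption on activation: $\phi$ locally Lipschitz and non-polynomial, $\phi'$ locally Lipschitz. Assumption on data: training inputs $x_1,\dots,x_N$ with $\|x_n\|_2=1$ and $x_n\ne x_{n'}$ for $n\neq n'$; labels $y\in\mathbb{R}^{CN}$; loss $\mathcal{L}(\theta)=\frac1{2N}\|y-f_\theta(x)\|^2$ where $f_\theta(x)\in\mathbb{R}^{CN}$ concatenates outputs on training inputs. $J(\theta)=\nabla_\theta f_\theta(x)$ ($CN\times P$), $J_t=J(\theta_t)$; $g(\theta):=f_\theta(x)-y$.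 $G(\theta)$ is a $P\times P$ metric matrix (an approximate Fisher information computed on the training inputs), $G_t=G(\theta_t)$, and NGD is $\theta_{t+1}=\theta_t-\eta G_t^{-1}\nabla_\theta\mathcal{L}(\theta_t)$ (inverses taken in the zero-damping sense). $B(\theta_0,D)=\{\theta:\|\theta-\theta_0\|_2<D\}$; $\bar\eta=\eta/N$; $\|\cdot\|_2$ on matrices is the spectral norm. $K>0$ is a constant such that for large $M$ and every $D>0$, with high probability $\|J(\theta)\|_F\le K$ and $\|J(\theta)-J(\tilde\theta)\|_F\le K\|\theta-\tilde\theta\|_2/\sqrt M$ for all $\theta,\tilde\theta\in B(\theta_0,D)$ (such a constant exists under these assumptions). $R_0>0$ is a constant with $\|g(\theta_0)\|_2<R_0$ with high probability. Condition 1 (isotropic condition): at initialization $J_0G_0^{-1}J_0^\top/N=\alpha I$ for a constant $\alpha>0$. Condition 2: there is $A>0$ such that for large $M$ and every $D>0$, with high probability, $\bar\eta\|G(\theta_s)^{-1}J(\theta_s)^\top\|_2\le A$ and $\bar\eta\|G_0^{-1}J_0^\top-G(\theta_s)^{-1}J(\theta_s)^\top\|_2\le A\|\theta_s-\theta_0\|_2/\sqrt M$ for all $\theta_s\in B(\theta_0,D)$. ''With high probability'' means with probability tending to $1$ as $M\to\infty$. *)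

(* Defs.v *)
From HB Require Import structures.
From mathcomp Require Import all_boot all_order all_algebra.
From mathcomp Require Import all_classical all_reals all_analysis.
Set Implicit Arguments. Unset Strict Implicit. Unset Printing Implicit Defensive.
Import Order.TTheory GRing.Theory Num.Theory.
Import numFieldNormedType.Exports.
Local Open Scope classical_set_scope.
Local Open Scope ring_scope.

Section NGDDefs.
Variable R : realType.

Definition cget n (v : 'cV[R]_n) (k : nat) : R :=
  if insub k is Some i then v i ord0 else 0.

Definition l2norm n (v : 'cV[R]_n) : R := Num.sqrt (\sum_i v i ord0 ^+ 2).

Definition frob m n (A : 'M[R]_(m, n)) : R :=
  Num.sqrt (\sum_i \sum_j A i j ^+ 2).

Definition specnorm m n (A : 'M[R]_(m, n)) : R :=
  sup [set l2norm (A *m v) | v in [set v : 'cV[R]_n | l2norm v <= 1]].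

(** zero-damping inverse applied to B:  G^{-1} B := lim_{rho -> 0+} (G + rho I)^{-1} B *)
Definition zdmul m k (G : 'M[R]_m) (B : 'M[R]_(m, k)) : 'M[R]_(m, k) :=
  lim ((fun rho : R => invmx (G + rho%:M) *m B) @ 0^'+).

Definition loclip (f : R -> R) : Prop :=
  forall r : R, 0 < r -> exists c : R, forall x y : R,
    `|x| <= r -> `|y| <= r -> `|f x - f y| <= c * `|x - y|.

Definition activation_ok (phi : R -> R) : Prop :=
  [/\ loclip phi,
      (forall x : R, derivable phi x 1),
      loclip (derive1 phi) &
      ~ (exists p : {poly R}, forall x : R, phi x = p.[x])].

Record NetCfg := {
  in_dim : nat;
  n_out : nat;
  n_data : nat;
  depth : nat;
  walpha : nat -> R;
  sigw : R;
  sigb : R;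
  act : R -> R;
  xs : 'I_n_data -> 'cV[R]_in_dim;
  ys : 'cV[R]_(n_out * n_data)
}.
Arguments xs : clear implicits.

Definition data_ok (c : NetCfg) : Prop :=
  (forall n, l2norm (xs c n) = 1) /\ injective (xs c).

Variables (c : NetCfg) (M : nat).

Definition width (l : nat) : nat :=
  match l with
  | 0 => in_dim c
  | l'.+1 => if l'.+1 == depth c then n_out c
             else Num.truncn (walpha c l'.+1 * M%:R)
  end.

(** parameter layout: layer l (1<=l<=L) stores W_l (row-major) then b_l *)
Definition offs (l : nat) : nat :=
  (\sum_(1 <= k < l) (width k * width k.-1 + width k))%N.

Definition npar : nat := offs (depth c).+1.

Definition Wmat (th : 'cV[R]_npar) (l : nat) : 'M[R]_(width l, width l.-1) :=
  \matrix_(i, j) cget th (offs l + i * width l.-1 + j).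

Definition bvec (th : 'cV[R]_npar) (l : nat) : 'cV[R]_(width l) :=
  \col_i cget th (offs l + width l * width l.-1 + i).

Definition preact (th : 'cV[R]_npar) (l : nat) (h : 'cV[R]_(width l))
  : 'cV[R]_(width l.+1) :=
  (sigw c / Num.sqrt (width l)%:R) *: (Wmat th l.+1 *m h) + sigb c *: bvec th l.+1.

Fixpoint hid (th : 'cV[R]_npar) (x : 'cV[R]_(in_dim c)) (l : nat)
  : 'cV[R]_(width l) :=
  match l with
  | 0 => x
  | l'.+1 => map_mx (act c) (preact th (hid th x l'))
  end.

Definition netout (th : 'cV[R]_npar) (x : 'cV[R]_(in_dim c)) (k : nat) : R :=
  cget (preact th (hid th x (depth c).-1)) k.

Definition xsn (n : nat) : 'cV[R]_(in_dim c) :=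
  if insub n is Some i then xs c i else 0.

(** f_theta(x) in R^{CN}: output c' on input n at index n*C + c' *)
Definition fvec (th : 'cV[R]_npar) : 'cV[R]_(n_out c * n_data c) :=
  \col_k netout th (xsn (k %/ n_out c)) (k %% n_out c).

Definition gres (th : 'cV[R]_npar) : 'cV[R]_(n_out c * n_data c) :=
  fvec th - ys c.

Definition loss (th : 'cV[R]_npar) : R :=
  ((n_data c)%:R *+ 2)^-1 * l2norm (gres th) ^+ 2.

Definition jac (th : 'cV[R]_npar) : 'M[R]_(n_out c * n_data c, npar) :=
  \matrix_(k, p) 'D_(delta_mx p ord0) (fun t : 'cV[R]_npar => fvec t k ord0) th.

Definition gradL (th : 'cV[R]_npar) : 'cV[R]_npar :=
  \col_p 'D_(delta_mx p ord0) loss th.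

Fixpoint ngd (G : 'cV[R]_npar -> 'M[R]_npar) (eta : R) (th0 : 'cV[R]_npar)
  (t : nat) : 'cV[R]_npar :=
  match t with
  | 0 => th0
  | t'.+1 => let th := ngd G eta th0 t' in th - eta *: zdmul (G th) (gradL th)
  end.

End NGDDefs.

(** "with high probability": P(E_M) -> 1 as M -> oo (inner probability) *)
Definition whp {R : realType} {dO : measure_display} {Omega : measurableType dO}
  (Pr : probability Omega R) (E : nat -> set Omega) : Prop :=
  forall eps : R, 0 < eps -> \forall M \near \oo,
    exists S : set Omega,
      [/\ measurable S, S `<=` E M & ((1 - eps)%:E <= Pr S)%E].

Definition std_gauss_init {R : realType} {dO : measure_display}
  {Omega : measurableType dO} (Pr : probability Omega R) (n : nat)
  (th0 : Omega -> 'cV[R]_n) : Prop :=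
  (forall i : 'I_n, measurable_fun setT (fun w => th0 w i ord0)) /\
  (forall B : 'I_n -> set R, (forall i, measurable (B i)) ->
     Pr [set w | forall i, B i (th0 w i ord0)] =
     (\prod_i fine (normal_prob 0 1 (B i)))%:E).

(* Main.v *)
Require Import Defs.
From HB Require Import structures.
From mathcomp Require Import all_boot all_order all_algebra.
From mathcomp Require Import all_classical all_reals all_analysis.
From mathcomp Require Import ring lra.
Import Order.TTheory GRing.Theory Num.Theory.
Import numFieldNormedType.Exports.
Local Open Scope classical_set_scope.
Local Open Scope ring_scope.

(** Write Z(th) = G(th)^-1 J(th)^T, D0 = 2 A R0 / (1 - q) and g_t = g(th_t). Since
    grad L = J^T g / N, one step of natural gradient descent is
    d = - (eta / N) Z(th_t) g_t, of norm at most A |g_t|, and the isotropic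
    condition gives
      g_{t+1} = (1 - eta alpha) g_t + (f(th_t + d) - f(th_t) - J0 d)
                + (eta / N) J0 (Z0 - Z(th_t)) g_t.
    As long as the iterates stay within D0 of th0, the mean value theorem with
    the Lipschitz bound on J controls the second term, and Condition 2 the third,
    each by K A D0 / sqrt M |g_t|; their sum is A' / sqrt M |g_t|. For large M the
    rate is at most (1 + q) / 2, so the step lengths sum to at most D0 and the
    iterates never leave that ball. *)

(** * Cauchy-Schwarz and the Euclidean, Frobenius and spectral norms *)

Section Euclid.
Set Implicit Arguments.
Unset Strict Implicit.
Variable R : realType.

(** Cauchy-Schwarz: the form [\sum_i (x * f i - y * g i) ^+ 2] is nonnegative, and at [x = b],
    [y = d] it equals [b * (a * b - d ^+ 2)]. Dividing by [b] leaves apart the case [b = 0], where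
    all [g i] vanish. *)
Lemma sqr_sum_le (I : finType) (f g : I -> R) :
  (\sum_i f i * g i) ^+ 2 <= (\sum_i f i ^+ 2) * (\sum_i g i ^+ 2).
Proof.
set a := \sum_i f i ^+ 2; set b := \sum_i g i ^+ 2; set d := \sum_i f i * g i.
have expand x y : \sum_i (x * f i - y * g i) ^+ 2
    = x ^+ 2 * a - 2 * x * y * d + y ^+ 2 * b.
  rewrite /a /b /d !mulr_sumr -sumrB -big_split /=.
  by apply: eq_bigr => i _; ring.
have ge0 x y : 0 <= x ^+ 2 * a - 2 * x * y * d + y ^+ 2 * b.
  by rewrite -expand; apply: sumr_ge0 => i _; exact: sqr_ge0.
have b_ge0 : 0 <= b by apply: sumr_ge0 => i _; exact: sqr_ge0.
have [b0|b_neq0] := eqVneq b 0.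
  have g0 i : g i = 0.
    move/eqP: b0; rewrite psumr_eq0 => [/allP/(_ i)|? _]; last exact: sqr_ge0.
    by rewrite mem_index_enum sqrf_eq0 => /(_ isT)/eqP.
  suff -> : d = 0 by rewrite b0 mulr0 expr0n.
  by apply: big1 => i _; rewrite g0 mulr0.
have b_gt0 : 0 < b by rewrite lt_def b_neq0.
have := ge0 b d.
have -> : b ^+ 2 * a - 2 * b * d * d + d ^+ 2 * b = b * (a * b - d ^+ 2) by ring.
by rewrite pmulr_rge0 // subr_ge0.
Qed.

Lemma sum_mul_le (I : finType) (f g : I -> R) :
  \sum_i f i * g i <= Num.sqrt (\sum_i f i ^+ 2) * Num.sqrt (\sum_i g i ^+ 2).
Proof.
rewrite -sqrtrM; last by apply: sumr_ge0 => i _; exact: sqr_ge0.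
apply: le_trans (ler_norm _) _.
by rewrite -sqrtr_sqr ler_wsqrtr // sqr_sum_le.
Qed.

Lemma l2norm_ge0 n (v : 'cV[R]_n) : 0 <= l2norm v.
Proof. exact: sqrtr_ge0. Qed.

Lemma sqr_l2norm n (v : 'cV[R]_n) : l2norm v ^+ 2 = \sum_i v i ord0 ^+ 2.
Proof. by rewrite sqr_sqrtr // sumr_ge0 // => i _; exact: sqr_ge0. Qed.

Lemma l2norm0 n : l2norm (0 : 'cV[R]_n) = 0.
Proof. by rewrite /l2norm big1 ?sqrtr0 // => i _; rewrite mxE expr0n. Qed.

Lemma l2normZ n a (v : 'cV[R]_n) : l2norm (a *: v) = `|a| * l2norm v.
Proof.
rewrite /l2norm -sqrtr_sqr -sqrtrM ?sqr_ge0 // mulr_sumr; congr Num.sqrt.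
by apply: eq_bigr => i _; rewrite mxE exprMn.
Qed.

Lemma l2normN n (v : 'cV[R]_n) : l2norm (- v) = l2norm v.
Proof. by rewrite -scaleN1r l2normZ normrN1 mul1r. Qed.

Lemma ler_l2normD n (u v : 'cV[R]_n) : l2norm (u + v) <= l2norm u + l2norm v.
Proof.
rewrite -(@ler_pXn2r _ 2) ?nnegrE ?addr_ge0 ?l2norm_ge0 //.
rewrite sqrrD !sqr_l2norm.
have -> : \sum_i (u + v) i ord0 ^+ 2 = \sum_i u i ord0 ^+ 2
    + (\sum_i u i ord0 * v i ord0) *+ 2 + \sum_i v i ord0 ^+ 2.
  rewrite -sumrMnl -!big_split /=.
  by apply: eq_bigr => i _; rewrite mxE sqrrD.
by rewrite lerD2r lerD2l lerMn2r /= sum_mul_le.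
Qed.

Lemma l2norm_eq0 n (v : 'cV[R]_n) : (l2norm v == 0) = (v == 0).
Proof.
apply/eqP/eqP => [v0|->]; last exact: l2norm0.
apply/matrixP => i j; rewrite ord1 mxE.
have /eqP := sqr_l2norm v; rewrite v0 expr0n /= eq_sym.
rewrite psumr_eq0 => [/allP/(_ i)|? _]; last exact: sqr_ge0.
by rewrite mem_index_enum sqrf_eq0 => /(_ isT)/eqP.
Qed.

Lemma l2norm_delta n (i : 'I_n) : l2norm (delta_mx i ord0 : 'cV[R]_n) = 1.
Proof.
rewrite /l2norm (bigD1 i) //= mxE !eqxx expr1n big1 ?addr0 ?sqrtr1 // => j ji.
by rewrite mxE (negbTE ji) expr0n.
Qed.

Lemma frob_ge0 m n (B : 'M[R]_(m, n)) : 0 <= frob B.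
Proof. exact: sqrtr_ge0. Qed.

Lemma ler_l2norm_frob m n (B : 'M[R]_(m, n)) (v : 'cV[R]_n) :
  l2norm (B *m v) <= frob B * l2norm v.
Proof.
have sq_ge0 k (F : 'I_k -> R) : 0 <= \sum_j F j ^+ 2.
  by apply: sumr_ge0 => j _; exact: sqr_ge0.
rewrite /l2norm /frob -sqrtrM; last by apply: sumr_ge0.
rewrite ler_wsqrtr // mulr_suml; apply: ler_sum => i _.
by rewrite mxE sqr_sum_le.
Qed.

Lemma ler_l2norm_specnorm m n (B : 'M[R]_(m, n)) (v : 'cV[R]_n) :
  l2norm (B *m v) <= specnorm B * l2norm v.
Proof.
have [->|v0] := eqVneq v 0; first by rewrite mulmx0 !l2norm0 mulr0.
have nv_gt0 : 0 < l2norm v by rewrite lt_def l2norm_ge0 l2norm_eq0 v0.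
rewrite -ler_pdivrMr //.
have -> : l2norm (B *m v) / l2norm v = l2norm (B *m ((l2norm v)^-1 *: v)).
  by rewrite -scalemxAr l2normZ ger0_norm ?invr_ge0 ?l2norm_ge0 // mulrC.
(* A [sup] dominates its set only if the set is bounded above; [frob B] is such a bound on the unit
   ball. *)
apply: ub_le_sup.
  exists (frob B) => _ [w /= w1 <-].
  by apply: le_trans (ler_l2norm_frob _ _) _; rewrite ler_piMr ?frob_ge0.
exists ((l2norm v)^-1 *: v) => //=.
by rewrite l2normZ ger0_norm ?invr_ge0 ?l2norm_ge0 // mulVf // gt_eqF.
Qed.

End Euclid.

(** * The zero-damping inverse and matrix products *)

Section ZeroDamping.
Set Implicit Arguments.
Unset Strict Implicit.
Variable R : realType.

Lemma continuous_mulmxr m n p (B : 'M[R]_(n, p)) :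
  continuous (fun X : 'M[R]_(m, n) => X *m B).
Proof.
move=> X s /= /(nbhs_ballP (X *m B)) [e /= e0 es].
(* The matrix norm here is the largest absolute entry, so the sum of all [|B j k|] is a Lipschitz
   constant; the added 1 keeps [c] positive when [B = 0]. *)
pose c := 1 + \sum_j \sum_k `|B j k|.
have c_gt0 : 0 < c.
  by rewrite ltr_pwDl // sumr_ge0 // => j _; rewrite sumr_ge0.
apply/nbhs_ballP; exists (e / c) => /=; first exact: divr_gt0.
move=> Y; rewrite -ball_normE /= => XY; apply: es.
rewrite -ball_normE /= -mulmxBl [ltLHS]/Num.norm /= mx_normrE.
apply: bigmax_lt => // -[i k] _ /=; rewrite mxE.
apply: le_lt_trans (_ : `|X - Y| * c < e); last by rewrite -ltr_pdivlMr.
apply: le_trans (ler_norm_sum _ _ _) _.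
apply: le_trans (_ : `|X - Y| * (\sum_j \sum_k `|B j k|) <= _); last first.
  by rewrite ler_wpM2l // lerDr.
rewrite mulr_sumr; apply: ler_sum => j _; rewrite normrM ler_pM //.
  by rewrite [leRHS]/Num.norm /= mx_normrE (le_bigmax _ _ (i, j)).
by rewrite (bigD1 k) //= lerDl sumr_ge0.
Qed.

(** The algorithm applies the inverse to the gradient, a multiple of [J^T g], while Condition 2
    speaks of the inverse applied to [J^T]. Continuity moves the factor out of the limit once that
    limit exists. *)
Lemma zdmul_cvg_mulmx m k p (G : 'M[R]_m) (B : 'M[R]_(m, k)) (C : 'M[R]_(k, p)) :
  cvg ((fun rho : R => invmx (G + rho%:M) *m B) @ 0^'+) ->
  zdmul G (B *m C) = zdmul G B *m C.
Proof.
move=> Bcvg; apply: cvg_lim => //.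
have -> : (fun rho : R => invmx (G + rho%:M) *m (B *m C)) =
    (fun X => X *m C) \o (fun rho : R => invmx (G + rho%:M) *m B).
  by apply/funext => rho /=; rewrite mulmxA.
by apply: continuous_cvg Bcvg; exact: continuous_mulmxr.
Qed.

(* A divergent [lim] is the default point of the matrix space, which is [0]. *)
Lemma zdmul_neq0_cvg m k (G : 'M[R]_m) (B : 'M[R]_(m, k)) :
  zdmul G B != 0 -> cvg ((fun rho : R => invmx (G + rho%:M) *m B) @ 0^'+).
Proof.
move=> /eqP; apply: contra_notP => /dvgP dvg; rewrite /zdmul dvg.
by apply/matrixP => i j; rewrite !mxE.
Qed.

(** Covers an empty output vector, where there is no unit vector on which to test the isotropic
    condition; the damped family is then constant. *)
Lemma zdmul_mulmx_thin m k p (G : 'M[R]_m) (B : 'M[R]_(m, k)) (C : 'M[R]_(k, p)) :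
  k = 0%N -> zdmul G (B *m C) = zdmul G B *m C.
Proof.
move=> k0; move: B C; rewrite {k}k0 => B C; apply: zdmul_cvg_mulmx.
have -> : (fun rho : R => invmx (G + rho%:M) *m B) = cst 0.
  by apply/funext => rho; exact: thinmx0.
exact: is_cvg_cst.
Qed.

End ZeroDamping.

(** * Differentiability of the network, gradient of the loss, linearization error *)

Section Derivatives.
Set Implicit Arguments.
Unset Strict Implicit.
Variable R : realType.

Lemma is_derive_line (V : normedModType R) (F : V -> R) (a v : V) (s : R) :
  differentiable F (a + s *: v) ->
  is_derive s (1 : R) (fun s : R => F (a + s *: v)) ('D_v F (a + s *: v)).
Proof.
move=> /diff_derivable dF; have {}dF := dF v.
(* Both sides have literally the same difference quotients, so existence and value of the derivative
   transfer together. *)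
have E : (fun h : R => h^-1 *: (((fun s => F (a + s *: v)) \o shift s) (h *: 1)
            - F (a + s *: v))) =
    (fun h : R => h^-1 *: ((F \o shift (a + s *: v)) (h *: v) - F (a + s *: v))).
  apply/funext => h /=; congr (_ *: (F _ - _)).
  by rewrite /shift /= scalerDl addrCA [h *: 1]mulr1.
by split; rewrite /derivable /derive E.
Qed.

Lemma derive_sum_delta n (F : 'cV[R]_n -> R) (a v : 'cV[R]_n) :
  differentiable F a ->
  'D_v F a = \sum_p v p ord0 * 'D_(delta_mx p ord0) F a.
Proof.
move=> dF; rewrite deriveE // {1}(matrix_sum_delta v).
rewrite linear_sum; apply: eq_bigr => i _.
by rewrite big_ord1 linearZ deriveE.
Qed.

Variables (c : NetCfg R) (M : nat).
Local Notation par := ('cV[R]_(npar c M)).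

Lemma differentiable_cget n (F : par -> 'cV[R]_n) k th :
  (forall i, differentiable (fun t => F t i ord0) th) ->
  differentiable (fun t => cget (F t) k) th.
Proof.
move=> dF; rewrite /cget; case: insubP => [i _ _|_]; first exact: dF.
exact: differentiable_cst.
Qed.

Lemma differentiable_cget_par k (th : par) :
  differentiable (fun t : par => cget t k) th.
Proof. by apply: differentiable_cget => i; exact: differentiable_coord. Qed.

Lemma differentiable_preact l (h : par -> 'cV[R]_(width c M l)) th :
  (forall i, differentiable (fun t => h t i ord0) th) ->
  forall i, differentiable (fun t => preact t (h t) i ord0) th.
Proof.
move=> dh i.
have -> : (fun t => preact t (h t) i ord0) =
   (fun t : par => (sigw c / Num.sqrt (width c M l)%:R) *:
     (\sum_(j < width c M l)
        ((fun t : par => cget t (offs c M l.+1 + i * width c M l + j)) *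
         (fun t => h t j ord0))) t
     + sigb c *: cget t (offs c M l.+1 + width c M l.+1 * width c M l + i)).
  apply/funext => t; rewrite !mxE fct_sumE /=; congr (_ * _ + _).
  by apply: eq_bigr => j _; rewrite !mxE.
apply: differentiableD; last first.
  exact: differentiableZ (differentiable_cget_par _ _).
apply: differentiableZ; apply: differentiable_sum => j.
by apply: differentiableM; [exact: differentiable_cget_par | exact: dh].
Qed.

Hypothesis act_derivable : forall x : R, derivable (act c) x 1.

Lemma differentiable_hid x l th :
  forall i, differentiable (fun t : par => hid t x l i ord0) th.
Proof.
elim: l => [|l IHl] i /=; first exact: differentiable_cst.
have -> : (fun t : par => map_mx (act c) (preact t (hid t x l)) i ord0) =
    act c \o (fun t : par => preact t (hid t x l) i ord0).
  by apply/funext => t; rewrite mxE.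
apply: differentiable_comp; first exact: differentiable_preact.
exact/derivable1_diffP.
Qed.

Lemma differentiable_fvec k th :
  differentiable (fun t : par => fvec t k ord0) th.
Proof.
have -> : (fun t : par => fvec t k ord0) =
    (fun t : par => netout t (xsn c (k %/ n_out c)) (k %% n_out c)).
  by apply/funext => t; rewrite mxE.
apply: differentiable_cget; apply: differentiable_preact.
exact: differentiable_hid.
Qed.

Lemma derive_fvec k (th v : par) :
  'D_v (fun t : par => fvec t k ord0) th = (jac th *m v) k ord0.
Proof.
rewrite derive_sum_delta; last exact: differentiable_fvec.
by rewrite mxE; apply: eq_bigr => p _; rewrite mxE mulrC.
Qed.

Lemma gradLE (th : par) :
  gradL th = (n_data c)%:R^-1 *: ((jac th)^T *m gres th).
Proof.
apply/matrixP => p j; rewrite ord1 !mxE.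
set v := delta_mx p ord0.
have dg k : is_derive th v (fun t : par => gres t k ord0) (jac th k p).
  have -> : (fun t : par => gres t k ord0) =
      (fun t => fvec t k ord0 - ys c k ord0).
    by apply/funext => t; rewrite !mxE.
  have df : is_derive th v (fun t : par => fvec t k ord0) (jac th k p).
    split; last by rewrite mxE.
    exact: diff_derivable (differentiable_fvec _ _).
  by have := is_deriveB df (is_derive_cst (ys c k ord0) th v); rewrite subr0.
have -> : @loss R c M = ((n_data c)%:R *+ 2)^-1 \*:
    \sum_k (fun t : par => gres t k ord0) ^+ 2.
  by apply/funext => t /=; rewrite /loss sqr_l2norm fct_sumE.
have /@derive_val -> := is_deriveZ ((n_data c)%:R *+ 2)^-1
  (is_derive_sum (fun k => is_deriveX 2 (dg k))).
rewrite -[_ *: _]/(_ * _) !mulr_sumr; apply: eq_bigr => k _.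
(* The 2 from differentiating the squares cancels the 2 in the prefactor of the loss. *)
rewrite mxE -[_ *: _]/(_ * _) /= expr1 -mulr_natr invfM.
rewrite -!mulrA; congr (_ * _); rewrite mulKf ?pnatr_eq0 //.
by rewrite mulrC [in RHS]mxE.
Qed.

(* The mean value theorem is applied to the scalar function
   [s |-> <u, f (th + s d) - s J d>] with [u] the vector being estimated. *)
Lemma fvec_linearization (J : 'M[R]_(n_out c * n_data c, npar c M))
    (th d : par) (L : R) :
  (forall s : R, 0 <= s <= 1 -> frob (jac (th + s *: d) - J) <= L) ->
  l2norm (fvec (th + d) - fvec th - J *m d) <= L * l2norm d.
Proof.
move=> HL; set u := fvec (th + d) - fvec th - J *m d.
pose psi (s : R) := \sum_k u k ord0 * (fvec (th + s *: d) - s *: (J *m d)) k ord0.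
pose dpsi (s : R) := \sum_k u k ord0 * ((jac (th + s *: d) - J) *m d) k ord0.
have coordBZ n (x y : 'cV[R]_n) a k :
    (x - a *: y) k ord0 = x k ord0 - a * y k ord0 by rewrite !mxE.
have psi_der (s : R) : is_derive s (1 : R) psi (dpsi s).
  have -> : psi = \sum_k (u k ord0 \*: ((fun s : R => fvec (th + s *: d) k ord0)
      - (fun s => s * (J *m d) k ord0))).
    apply/funext => s'; rewrite fct_sumE /psi; apply: eq_bigr => k _ /=.
    by rewrite coordBZ.
  have -> : dpsi s = \sum_k u k ord0 *:
      ((jac (th + s *: d) *m d) k ord0 - (J *m d) k ord0).
    apply: eq_bigr => k _; congr (_ * _).
    by rewrite mulmxBl -[in LHS](scale1r (J *m d)) coordBZ mul1r.
  apply: is_derive_sum => k; apply: is_deriveZ.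
  apply: is_deriveB.
    have := is_derive_line (differentiable_fvec k (th + s *: d)).
    by rewrite derive_fvec.
  have := is_deriveZ ((J *m d) k ord0) (is_derive_id s (1 : R)).
  rewrite -[_ *: 1]/(_ * 1) mulr1.
  by have -> : (J *m d) k ord0 \*: id = (fun s : R => s * (J *m d) k ord0)
    by apply/funext => ? /=; rewrite mulrC.
have psi_cont : {within `[0, 1], continuous psi}.
  by apply: derivable_within_continuous => s _; have [] := psi_der s.
have [s /[!in_itv]/= /andP[s0 s1]] :=
  MVT ltr01 (fun s _ => psi_der s) psi_cont.
rewrite subr0 mulr1 => psi_mvt.
have psi01 : psi 1 - psi 0 = l2norm u ^+ 2.
  rewrite /psi -sumrB sqr_l2norm; apply: eq_bigr => k _.
  rewrite -mulrBr expr2; congr (_ * _).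
  rewrite scale1r !scale0r addr0 subr0 /u addrAC.
  rewrite -[in RHS](scale1r (fvec th)) -[in RHS](scale1r (J *m d)).
  by rewrite !coordBZ !mul1r.
(* The mean value theorem yields [|u|^2 <= |u| * (L * |d|)], from which one factor [|u|] is
   cancelled. For [u = 0] it remains to see [0 <= L], which [HL] at [s = 0] gives. *)
have [->|u0] := eqVneq (l2norm u) 0.
  apply: mulr_ge0; last exact: l2norm_ge0.
  by apply: le_trans (frob_ge0 _) (HL 0 _); rewrite lexx ler01.
have u_gt0 : 0 < l2norm u by rewrite lt_def u0 l2norm_ge0.
rewrite -(ler_pM2l u_gt0) -expr2 -psi01 psi_mvt.
apply: le_trans (sum_mul_le _ _) _.
rewrite ler_pM2l //; apply: le_trans (ler_l2norm_frob _ _) _.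
by rewrite ler_wpM2r ?l2norm_ge0 // HL // !ltW.
Qed.

End Derivatives.

(** With [s] for [eta / N], [b] for [eta * alpha] and [d = - s Z g], add and subtract [J0 d]:
    replacing [Z] by [Z0] turns it into [- b g], and the replacement costs the last term. *)
Lemma residual_split (R : realType) m n (J0 : 'M[R]_(m, n)) (Z0 Z : 'M[R]_(n, m))
    (f' f y : 'cV[R]_m) (s b : R) :
  s *: (J0 *m Z0) = b%:M ->
  f' - y = (1 - b) *: (f - y) + (f' - f - J0 *m - (s *: (Z *m (f - y))))
    + s *: (J0 *m ((Z0 - Z) *m (f - y))).
Proof.
move=> isotropic; set g := f - y.
have -> : s *: (J0 *m ((Z0 - Z) *m g)) = b *: g - s *: (J0 *m (Z *m g)).
  rewrite mulmxBl mulmxBr scalerBr; congr (_ - _).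
  by rewrite mulmxA scalemxAl isotropic mul_scalar_mx.
rewrite mulmxN -scalemxAr scalerBl scale1r opprK /g.
by apply/matrixP => i j; rewrite !mxE; ring.
Qed.

(** The sum times [1 - r] telescopes to [1 - r ^+ t <= 1], and [1 - r >= (1 - q) / 2]. *)
Lemma geometric_sum_le (R : realType) (q r : R) t :
  q < 1 -> 0 <= r -> r <= (1 + q) / 2 ->
  \sum_(1 <= j < t.+1) r ^+ j.-1 <= 2 / (1 - q).
Proof.
move=> q_lt1 r_ge0 r_le; have q1 : 0 < 1 - q by rewrite subr_gt0.
rewrite ler_pdivlMr // -[leRHS]mul1r mulrC.
have sumE : (1 - r) * \sum_(1 <= j < t.+1) r ^+ j.-1 = 1 - r ^+ t.
  elim: t => [|t IHt]; first by rewrite big_geq // mulr0 expr0 subrr.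
  by rewrite big_nat_recr //= mulrDr IHt exprS; ring.
have sum_ge0 : 0 <= \sum_(1 <= j < t.+1) r ^+ j.-1.
  by apply: sumr_ge0 => j _; exact: exprn_ge0.
have := exprn_ge0 t r_ge0.
move: sumE sum_ge0; move: (\sum_(_ <= _ < _) _) (r ^+ t) => S rt SE S_ge0 rt_ge0.
nra.
Qed.

(** * Deterministic analysis of the iterates for one fixed initialization *)

Section Dynamics.
Set Implicit Arguments.
Unset Strict Implicit.
Variables (R : realType) (c : NetCfg R) (M : nat).
Local Notation par := ('cV[R]_(npar c M)).
Variables (th0 : par) (G : par -> 'M[R]_(npar c M)).
Variables (eta alpha A K R0 D : R).
Local Notation sM := (Num.sqrt M%:R : R).
Local Notation N := ((n_data c)%:R : R).
Local Notation Z th := (zdmul (G th) (jac th)^T).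
Local Notation q := (`|1 - eta * alpha|).
Local Notation D0 := (2 * A * R0 / (1 - q)).
Local Notation rho := (q + 4 * K * A ^+ 2 * R0 / (1 - q) / sM).

Hypothesis act_derivable : forall x : R, derivable (act c) x 1.
Hypotheses (M_gt0 : 0 < sM) (eta_gt0 : 0 < eta) (alpha_gt0 : 0 < alpha).
Hypotheses (K_gt0 : 0 < K) (A_gt0 : 0 < A) (R0_gt0 : 0 < R0) (q_lt1 : q < 1).
Hypothesis jac_lip : forall th th' : par,
  l2norm (th - th0) < D -> l2norm (th' - th0) < D ->
  frob (jac th) <= K /\ frob (jac th - jac th') <= K * l2norm (th - th') / sM.
Hypothesis isotropic : N^-1 *: (jac th0 *m Z th0) = alpha%:M.
Hypothesis zd_lip : forall th : par, l2norm (th - th0) < D ->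
  eta / N * specnorm (Z th) <= A /\
  eta / N * specnorm (Z th0 - Z th) <= A * l2norm (th - th0) / sM.
(** Used to rule out [Z th = 0] in the ball when the output vector is nonempty. *)
Hypothesis M_large : K * A * D / sM < eta * alpha.
(** The iterates are bounded by [D0] non-strictly, whereas the local hypotheses hold on an open
    ball. *)
Hypothesis D0_ltD : D0 < D.

Let D0_ge0 : 0 <= D0.
Proof. by rewrite divr_ge0 ?mulr_ge0 ?subr_ge0 // ltW. Qed.

Let th0_ball : l2norm (th0 - th0) < D.
Proof. by rewrite subrr l2norm0 (le_lt_trans D0_ge0). Qed.

Let etaN_ge0 : 0 <= eta / N.
Proof. by rewrite divr_ge0 // ltW. Qed.

(* If the limit defining [Z th] did not exist, [Z th] would be [0] and Condition
   2 would make [Z th0] too small for the isotropic condition. *)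
Lemma zdmul_jac_mulmx (th : par) (v : 'cV[R]_(n_out c * n_data c)) :
  l2norm (th - th0) < D -> zdmul (G th) ((jac th)^T *m v) = Z th *m v.
Proof.
move=> th_ball; have [k0|k_gt0] := posnP (n_out c * n_data c)%N.
  exact: zdmul_mulmx_thin.
apply/zdmul_cvg_mulmx/zdmul_neq0_cvg/eqP => Z0.
have [_] := zd_lip th_ball; rewrite Z0 subr0 => spec_le.
pose e : 'cV[R]_(n_out c * n_data c) := delta_mx (Ordinal k_gt0) ord0.
have e1 : l2norm e = 1 by exact: l2norm_delta.
(* Testing the isotropic condition on a unit vector bounds [alpha] by [K * specnorm (Z th0) / N];
   with [Z th = 0], Condition 2 then gives [eta * alpha <= K * A * D / sM]. *)
have alphaE : alpha = N^-1 * l2norm (jac th0 *m (Z th0 *m e)).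
  have -> : alpha = l2norm (alpha *: e) by rewrite l2normZ e1 mulr1 gtr0_norm.
  by rewrite -mul_scalar_mx -isotropic -scalemxAl l2normZ mulmxA ger0_norm.
suff : eta * alpha <= K * A * D / sM by rewrite leNgt M_large.
rewrite alphaE mulrA.
apply: le_trans (_ : eta / N * (K * specnorm (Z th0)) <= _).
  rewrite ler_wpM2l //; apply: le_trans (ler_l2norm_frob _ _) _.
  have [frobK _] := jac_lip th0_ball th0_ball.
  apply: ler_pM; rewrite ?frob_ge0 ?l2norm_ge0 //.
  by rewrite -[leRHS]mulr1 -e1 ler_l2norm_specnorm.
rewrite mulrCA -![in leRHS]mulrA ler_pM2l //; apply: le_trans spec_le _.
by rewrite -mulrA ler_pM2l // ler_pM2r ?invr_gt0 // ltW.
Qed.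

Lemma ngd_stepE (th : par) : l2norm (th - th0) < D ->
  eta *: zdmul (G th) (gradL th) = (eta / N) *: (Z th *m gres th).
Proof.
move=> th_ball; rewrite gradLE // scalemxAr zdmul_jac_mulmx //.
by rewrite -scalemxAr scalerA.
Qed.

Lemma ngd_step_le (th : par) : l2norm (th - th0) < D ->
  l2norm (eta *: zdmul (G th) (gradL th)) <= A * l2norm (gres th).
Proof.
move=> th_ball; rewrite ngd_stepE // l2normZ ger0_norm //.
apply: le_trans (_ : eta / N * (specnorm (Z th) * l2norm (gres th)) <= _).
  by rewrite ler_wpM2l // ler_l2norm_specnorm.
by rewrite mulrA ler_wpM2r ?l2norm_ge0 //; have [] := zd_lip th_ball.
Qed.

(** Both endpoints are assumed within [D0] because the mean value bound needs the whole segment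
    there. The Jacobian is compared with the one at [th0], which gives the factor [D0 / sM]. *)
Lemma ngd_step_contract (th : par) :
  let th' := th - eta *: zdmul (G th) (gradL th) in
  l2norm (th - th0) <= D0 -> l2norm (th' - th0) <= D0 ->
  l2norm (gres th') <= rho * l2norm (gres th).
Proof.
move=> th' th_D0 th'_D0; have th_ball := le_lt_trans th_D0 D0_ltD.
set g := gres th; pose d := - ((eta / N) *: (Z th *m g)).
have th'E : th' = th + d by rewrite /th' ngd_stepE.
have d_le : l2norm d <= A * l2norm g.
  by rewrite /d l2normN -ngd_stepE // ngd_step_le.
have gE : gres th' = (1 - eta * alpha) *: g
    + (fvec (th + d) - fvec th - jac th0 *m d)
    + (eta / N) *: (jac th0 *m ((Z th0 - Z th) *m g)).
  rewrite /d /g /gres th'E; apply: residual_split.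
  by rewrite -scalerA isotropic scale_scalar_mx.
have seg_ball s : 0 <= s <= 1 -> l2norm (th + s *: d - th0) <= D0.
  move=> /andP[s0 s1].
  have -> : th + s *: d - th0 = (1 - s) *: (th - th0) + s *: (th' - th0).
    by rewrite th'E; apply/matrixP => i j; rewrite !mxE; ring.
  apply: le_trans (ler_l2normD _ _) _; rewrite !l2normZ.
  rewrite (ger0_norm s0) (@ger0_norm _ (1 - s)) ?subr_ge0 //.
  apply: le_trans (_ : (1 - s) * D0 + s * D0 <= _).
    by rewrite lerD // ler_wpM2l // subr_ge0.
  by rewrite -mulrDl subrK mul1r.
have E1_le : l2norm (fvec (th + d) - fvec th - jac th0 *m d)
    <= K * D0 / sM * (A * l2norm g).
  have L_ge0 : 0 <= K * D0 / sM.
    by rewrite divr_ge0 ?(ltW M_gt0) // mulr_ge0 ?(ltW K_gt0).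
  apply: le_trans (ler_wpM2l L_ge0 d_le).
  apply: fvec_linearization => // s /seg_ball s_D0.
  have [_] := jac_lip (le_lt_trans s_D0 D0_ltD) th0_ball.
  move/le_trans; apply.
  by rewrite ler_pM2r ?invr_gt0 // ler_pM2l.
have E2_le : l2norm ((eta / N) *: (jac th0 *m ((Z th0 - Z th) *m g)))
    <= K * (A * D0 / sM * l2norm g).
  rewrite l2normZ ger0_norm //.
  apply: le_trans (_ : eta / N * (K * (specnorm (Z th0 - Z th) * l2norm g)) <= _).
    rewrite ler_wpM2l //; apply: le_trans (ler_l2norm_frob _ _) _.
    have [frobK _] := jac_lip th0_ball th0_ball.
    apply: ler_pM; rewrite ?frob_ge0 ?l2norm_ge0 //.
    exact: ler_l2norm_specnorm.
  rewrite mulrCA ler_pM2l // [leLHS]mulrA ler_wpM2r ?l2norm_ge0 //.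
  have [_] := zd_lip th_ball; move/le_trans; apply.
  by rewrite ler_pM2r ?invr_gt0 // ler_pM2l.
rewrite gE; apply: le_trans (ler_l2normD _ _) _.
apply: le_trans (lerD (ler_l2normD _ _) (lexx _)) _.
apply: le_trans (lerD (lerD (lexx _) E1_le) E2_le) _.
(* The two sides agree: the errors add up to [2 * K * A * D0 / sM], and inserting [D0] produces the
   constant 4 in [rho]. *)
rewrite l2normZ le_eqVlt; apply/orP; left; apply/eqP.
by ring.
Qed.

Hypothesis gres0_lt : l2norm (gres th0) < R0.
Hypothesis rho_le : rho <= (1 + q) / 2.

Lemma ngd_convergence t :
  [/\ l2norm (gres (ngd G eta th0 t)) <= rho ^+ t * R0,
      \sum_(1 <= j < t.+1) l2norm (ngd G eta th0 j - ngd G eta th0 j.-1)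
        <= A * R0 * \sum_(1 <= j < t.+1) rho ^+ j.-1 &
      A * R0 * \sum_(1 <= j < t.+1) rho ^+ j.-1 <= D0].
Proof.
have rho_ge0 : 0 <= rho.
  rewrite addr_ge0 // divr_ge0 ?(ltW M_gt0) // divr_ge0 ?subr_ge0 ?ltW //.
  by rewrite !mulr_gt0 // exprn_gt0.
have sum_le k : A * R0 * \sum_(1 <= j < k.+1) rho ^+ j.-1 <= D0.
  have -> : D0 = A * R0 * (2 / (1 - q)) by ring.
  by rewrite ler_pM2l ?mulr_gt0 // geometric_sum_le.
pose S k := \sum_(1 <= j < k.+1) l2norm (ngd G eta th0 j - ngd G eta th0 j.-1).
(* The induction also carries that the displacement from [th0] is at most the path length [S t],
   which keeps the iterates in the ball. *)
suff [? ? _] : [/\ l2norm (gres (ngd G eta th0 t)) <= rho ^+ t * R0,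
    S t <= A * R0 * \sum_(1 <= j < t.+1) rho ^+ j.-1 &
    l2norm (ngd G eta th0 t - th0) <= S t] by [].
elim: t => [|t [IHg IHS IHd]].
  rewrite /S !big_geq // mulr0 subrr l2norm0 expr0 mul1r /=.
  by split=> //; exact: ltW.
set th := ngd G eta th0 t in IHg IHd *.
have th_D0 : l2norm (th - th0) <= D0.
  exact: le_trans IHd (le_trans IHS (sum_le t)).
have stepE : ngd G eta th0 t.+1 - th = - (eta *: zdmul (G th) (gradL th)).
  by rewrite /= -/th addrAC subrr add0r.
have S_rec : S t.+1 = S t + l2norm (ngd G eta th0 t.+1 - th).
  by rewrite /S big_nat_recr.
(* The step length depends only on the current residual, so the next iterate is placed in the ball
   before contraction is invoked. *)
have S_le : S t.+1 <= A * R0 * \sum_(1 <= j < t.+2) rho ^+ j.-1.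
  rewrite S_rec [in leRHS]big_nat_recr //= mulrDr lerD // stepE l2normN.
  apply: le_trans (ngd_step_le (le_lt_trans th_D0 D0_ltD)) _.
  by rewrite -mulrA ler_pM2l // mulrC.
have d_le : l2norm (ngd G eta th0 t.+1 - th0) <= S t.+1.
  rewrite S_rec [leRHS]addrC -(subrKA th); apply: le_trans (ler_l2normD _ _) _.
  by rewrite lerD2l.
split=> //; rewrite exprS -mulrA.
apply: le_trans (ler_wpM2l rho_ge0 IHg).
apply: ngd_step_contract => //.
exact: le_trans d_le (le_trans S_le (sum_le _)).
Qed.

End Dynamics.

(** * Events of high probability and thresholds on [M] *)

Section WithHighProbability.
Set Implicit Arguments.
Unset Strict Implicit.
Variables (R : realType) (dO : measure_display) (Omega : measurableType dO).
Variable Pr : probability Omega R.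

(** A union bound on the complements of the measurable inner sets, each of probability at most
    [e / 2]. *)
Lemma whpI (E F : nat -> set Omega) :
  whp Pr E -> whp Pr F -> whp Pr (fun M => E M `&` F M).
Proof.
move=> hE hF e e0; have e2 : 0 < e / 2 by rewrite divr_gt0.
near=> M.
have [S [mS SE PS]] : exists S, [/\ measurable S, S `<=` E M &
  ((1 - e / 2)%:E <= Pr S)%E] by near: M; exact: hE.
have [T [mT TF PT]] : exists S, [/\ measurable S, S `<=` F M &
  ((1 - e / 2)%:E <= Pr S)%E] by near: M; exact: hF.
exists (S `&` T); split; first exact: measurableI.
  by move=> w [/SE ? /TF].
have mSC := measurableC mS; have mTC := measurableC mT.
have : (Pr (~` S `|` ~` T) <= Pr (~` S) + Pr (~` T))%E by exact: measureU2.
rewrite -setCI.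
rewrite !probability_setC //; last exact: measurableI.
rewrite -[Pr S]fineK ?fin_num_measure // -[Pr T]fineK ?fin_num_measure //.
have mST := measurableI _ _ mS mT.
rewrite -[Pr (_ `&` _)]fineK ?fin_num_measure //.
move: PS PT; rewrite -[Pr S]fineK ?fin_num_measure //.
rewrite -[Pr T]fineK ?fin_num_measure //= -!EFinB -EFinD !lee_fin.
by lra.
Unshelve. all: by end_near. Qed.

(** Asking for the inclusion only eventually lets the argument assume [M] large. *)
Lemma whpW (E F : nat -> set Omega) :
  (\forall M \near \oo, E M `<=` F M) -> whp Pr E -> whp Pr F.
Proof.
move=> EF hE e e0; near=> M.
have [S [mS SE PS]] : exists S, [/\ measurable S, S `<=` E M &
  ((1 - e)%:E <= Pr S)%E] by near: M; exact: hE.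
exists S; split => //; apply: subset_trans SE _.
by near: M.
Unshelve. all: by end_near. Qed.

End WithHighProbability.

Lemma near_div_sqrt_lt (R : realType) (a e : R) : 0 < e ->
  \forall M \near \oo, 0 < Num.sqrt M%:R :> R /\ a / Num.sqrt M%:R < e.
Proof.
move=> e0; near=> M.
(* Squaring handles either sign of [a] and also makes [M] positive. *)
have M_gt : (a / e) ^+ 2 < M%:R by near: M; exact: nbhs_infty_gtr.
have sM : `|a / e| < Num.sqrt M%:R.
  by rewrite -sqrtr_sqr ltr_sqrt // (le_lt_trans _ M_gt) // sqr_ge0.
have sM_gt0 : 0 < Num.sqrt M%:R :> R by apply: le_lt_trans sM.
split=> //; rewrite ltr_pdivrMr // mulrC -ltr_pdivrMr //.
exact: le_lt_trans (ler_norm _) sM.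
Unshelve. all: by end_near. Qed.

Theorem theoremA2 (R : realType) (c : NetCfg R)
  (dO : measure_display) (Omega : measurableType dO) (Pr : probability Omega R)
  (th0 : forall M : nat, Omega -> 'cV[R]_(npar c M))
  (G : forall M : nat, 'cV[R]_(npar c M) -> 'M[R]_(npar c M))
  (eta alpha A K R0 : R) :
  (* architecture *)
  (0 < depth c)%N ->
  (forall l : nat, (0 < l < depth c)%N -> 0 < walpha c l) ->
  (* assumptions on the activation and the data *)
  activation_ok (act c) ->
  data_ok c ->
  (* initialization: all entries i.i.d. N(0,1) *)
  (forall M : nat, std_gauss_init Pr (th0 M)) ->
  (* the constant K *)
  0 < K ->
  (forall D : R, 0 < D -> whp Pr (fun M => [set w |
     forall th th' : 'cV[R]_(npar c M),
       l2norm (th - th0 M w) < D -> l2norm (th' - th0 M w) < D ->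
       frob (jac th) <= K /\
       frob (jac th - jac th') <= K * l2norm (th - th') / Num.sqrt M%:R])) ->
  (* the constant R0 *)
  0 < R0 ->
  whp Pr (fun M => [set w | l2norm (gres (th0 M w)) < R0]) ->
  (* Condition 1 (isotropic condition) *)
  0 < alpha ->
  whp Pr (fun M => [set w |
     ((n_data c)%:R^-1 *: (jac (th0 M w) *m
        zdmul (G M (th0 M w)) (jac (th0 M w))^T)) = alpha%:M]) ->
  (* Condition 2 *)
  0 < A ->
  (forall D : R, 0 < D -> whp Pr (fun M => [set w |
     forall ths : 'cV[R]_(npar c M), l2norm (ths - th0 M w) < D ->
       eta / (n_data c)%:R * specnorm (zdmul (G M ths) (jac ths)^T) <= A /\
       eta / (n_data c)%:R *
         specnorm (zdmul (G M (th0 M w)) (jac (th0 M w))^T -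
                   zdmul (G M ths) (jac ths)^T)
         <= A * l2norm (ths - th0 M w) / Num.sqrt M%:R])) ->
  (* step size *)
  0 < eta * alpha < 2 ->
  let q := `|1 - eta * alpha| in
  let A' := 4 * K * A ^+ 2 * R0 / (1 - q) in
  whp Pr (fun M => [set w | forall t : nat,
     let th := ngd (G M) eta (th0 M w) in
     let rho := q + A' / Num.sqrt M%:R in
     l2norm (gres (th t)) <= rho ^+ t * R0 /\
     \sum_(1 <= j < t.+1) l2norm (th j - th j.-1)
       <= A * R0 * \sum_(1 <= j < t.+1) rho ^+ j.-1 /\
     A * R0 * \sum_(1 <= j < t.+1) rho ^+ j.-1 <= 2 * A * R0 / (1 - q)]).
Proof.
move=> _ _ [_ act_der _ _] _ _ K_gt0 hK R0_gt0 hR0 alpha_gt0 hIso A_gt0 hZ ea.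
move=> q A'; have [ea_gt0 ea_lt2] := andP ea.
have eta_gt0 : 0 < eta by rewrite -(pmulr_lgt0 _ alpha_gt0).
have q_lt1 : q < 1 by rewrite /q ltr_norml; apply/andP; split; lra.
(* Any radius above [D0] that is independent of [M] would serve. *)
pose D := 2 * A * R0 / (1 - q) + 1.
have D_gt0 : 0 < D.
  by rewrite ltr_wpDl // divr_ge0 ?mulr_ge0 ?subr_ge0 // ltW.
apply: whpW (whpI (whpI (hK D D_gt0) hR0) (whpI hIso (hZ D D_gt0))).
(* Two thresholds on [M]: one puts the rate below [(1 + q) / 2], the other secures convergence of
   the zero-damping limits. *)
have rho_near := @near_div_sqrt_lt R A' ((1 - q) / 2).
have kad_near := @near_div_sqrt_lt R (K * A * D) _ ea_gt0.
near=> M => w [[wK wR0] [wIso wZ]] t.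
have [sM_gt0 M_large] : 0 < Num.sqrt M%:R :> R /\
  K * A * D / Num.sqrt M%:R < eta * alpha by near: M; exact: kad_near.
have [_ rho_lt] : 0 < Num.sqrt M%:R :> R /\ A' / Num.sqrt M%:R < (1 - q) / 2.
  by near: M; apply: rho_near; rewrite divr_gt0 ?subr_gt0.
have rho_le : q + A' / Num.sqrt M%:R <= (1 + q) / 2.
  by move: rho_lt; lra.
have D0_ltD : 2 * A * R0 / (1 - q) < D by rewrite ltrDl.
by have [] := ngd_convergence act_der sM_gt0 eta_gt0 alpha_gt0 K_gt0 A_gt0
  R0_gt0 q_lt1 wK wIso wZ M_large D0_ltD wR0 rho_le t.
Unshelve. all: by end_near. Qed.
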